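(* Let $\omega=\omega(n)$ be any function with $\omega(n)\to\infty$ as $n\to\infty$, and let $\delta\in(0,1)$ be a constant. Suppose the edge-probability $p=p(n)$ satisfies $n^{-1/2+\delta}\ll p\le 1-\delta$. Then there is an interval of length $\lfloor \omega\sqrt{n}\,p/\log n\rfloor$ that contains the chromatic number $\chi(G_{n,p})$ with high probability.
   Context: $G_{n,p}$ denotes the binomial random graph on vertex set $[n]=\{1,\dots,n\}$ in which each pair of vertices is an edge independently with probability $p$. $\chi(G)$ is the chromatic number of a graph $G$. For positive functions, $a\ll b$ means $a/b\to 0$ as $n\to\infty$. ''With high probability'' means with probability tending to $1$ as $n\to\infty$. ''There is an interval of length $\ell=\ell(n)$ that contains $\chi(G_{n,p})$ with high probability'' means there exist intervals $I_n$ of length $\ell(n)$ with $\Pr(\chi(G_{n,p})\in I_n)\to 1$ as $n\to\infty$. *)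

(* Defs.v *)
From HB Require Import structures.
From mathcomp Require Import all_boot all_order all_algebra.
From mathcomp Require Import all_classical all_reals all_analysis.
Set Implicit Arguments. Unset Strict Implicit. Unset Printing Implicit Defensive.
Import Order.TTheory GRing.Theory Num.Theory.
Local Open Scope ring_scope.

(* A simple graph on vertex set 'I_n (= [n]) is a set of 2-element subsets. *)
Definition pairs (n : nat) : {set {set 'I_n}} := [set e : {set 'I_n} | #|e| == 2%N].

Definition colorable (n : nat) (E : {set {set 'I_n}}) (k : nat) : bool :=
  [exists c : {ffun 'I_n -> 'I_k},
     [forall e in E, forall x in e, forall y in e, (x != y) ==> (c x != c y)]].

(* chromatic number: least k such that E is k-colourable (k = n always works) *)
Definition chi (n : nat) (E : {set {set 'I_n}}) : nat :=
  find (colorable E) (iota 0 n.+1).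

Definition Pr_Gnp (R : realType) (n : nat) (p : R) (P : {set {set 'I_n}} -> bool) : R :=
  \sum_(E : {set {set 'I_n}} | (E \subset pairs n) && P E)
     p ^+ #|E| * (1 - p) ^+ (#|pairs n| - #|E|).

(* Main.v *)
(**
Fix eps > 0, let b be the least integer with P(chi <= b) >= eps, and let Y be
the least number of vertices whose deletion leaves a b-colourable graph.
Exposing the edges vertex by vertex changes Y by at most 1 per step, so
Var Y <= n; since P(Y = 0) >= eps, Chebyshev's inequality applied twice gives
Y <= 2 sqrt (n / eps) outside an event of probability eps.

It remains to colour the deleted vertices cheaply.  With high probability every
non-empty vertex set S has a subset U with 2 |U| >= |S| that is colourable with
r = O(|S| p / ln n + n^(delta/2)) colours: otherwise take a largest
r-colourable U in S; every vertex of S outside U has a neighbour in each of the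
r colour classes, which has probability at most
exp (- |S \ U| r (1 - p)^(|S| / r)), and this beats the union bound over S and
over all partial colourings of S.  Iterating the halving, every set of
O(sqrt n) vertices is colourable with O(sqrt n p / ln n) colours, so chi lies
in [b, b + O(sqrt n p / ln n)] with probability at least 1 - 2 eps - o(1).
*)
Require Import Defs.
From HB Require Import structures.
From mathcomp Require Import all_boot all_order all_algebra.
From mathcomp Require Import all_classical all_reals all_analysis.
(* Loaded again so that set0, subsetP, ... denote the finite-set versions. *)
From mathcomp Require Import fintype finset ring lra zify.
Set Implicit Arguments. Unset Strict Implicit. Unset Printing Implicit Defensive.
Import Order.TTheory GRing.Theory Num.Theory.
Import numFieldNormedType.Exports.
Local Open Scope ring_scope.

(** * Expectation and probability over a [p]-random subset of a finite set *)

Section RandomSubset.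
Variables (R : realType) (T : finType) (p : R).
Implicit Types (A B D E F : {set T}) (f g : {set T} -> R).

Definition weight D E : R := p ^+ #|E| * (1 - p) ^+ (#|D| - #|E|).

Definition expect D f : R := \sum_(E : {set T} | E \subset D) weight D E * f E.

Definition prob D (P : {set T} -> bool) : R := expect D (fun E => (P E)%:R).

Lemma weightU A B E F : [disjoint A & B] -> E \subset A -> F \subset B ->
  weight (A :|: B) (E :|: F) = weight A E * weight B F.
Proof.
move=> dAB sEA sFB; have dEF : [disjoint E & F].
  by apply: disjointWl sEA _; apply: disjointWr sFB _.
rewrite /weight !cardsU !disjoint_setI0 // !cards0 !subn0.
have [lE lF] := (subset_leq_card sEA, subset_leq_card sFB).
have -> : (#|A| + #|B| - (#|E| + #|F|) = (#|A| - #|E|) + (#|B| - #|F|))%N by lia.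
by rewrite !exprD; ring.
Qed.

(** Subsets of [A :|: B] correspond to pairs of subsets of [A] and [B], and the weights multiply.
    This Fubini rule is the form in which independence enters the arguments below. *)
Lemma expectU A B f : [disjoint A & B] ->
  expect (A :|: B) f = expect A (fun E => expect B (fun F => f (E :|: F))).
Proof.
move=> dAB; rewrite /expect; under [RHS]eq_bigr do rewrite big_distrr /=.
rewrite pair_big_dep /=.
rewrite (reindex_onto (fun EF : {set T} * {set T} => EF.1 :|: EF.2)
  (fun E => (E :&: A, E :&: B))) /=; last first.
  by move=> E sE; rewrite -setIUr; apply/setIidPl.
apply: eq_big => [[E F] /=|[E F] /= /andP[_ /eqP[<- <-]]]; last first.
  by rewrite mulrA weightU ?subsetIr.
apply/andP/andP => [[sEF /eqP[<- <-]]|[sE sF]]; first by rewrite !subsetIr.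
have EB : E :&: B = set0.
  by apply: disjoint_setI0; apply: disjointWl sE _.
have FA : F :&: A = set0.
  by apply: disjoint_setI0; rewrite disjoint_sym; apply: disjointWr sF _.
split; first exact: setUSS.
apply/eqP; congr pair.
  by rewrite setIUl FA setU0; apply/setIidPl.
by rewrite setIUl EB set0U; apply/setIidPl.
Qed.

Lemma eq_expect D f g : (forall E, E \subset D -> f E = g E) ->
  expect D f = expect D g.
Proof. by move=> fg; apply: eq_bigr => E /fg ->. Qed.

Lemma expectD D f g : expect D (fun E => f E + g E) = expect D f + expect D g.
Proof. by rewrite -big_split; apply: eq_bigr => E _; rewrite mulrDr. Qed.

Lemma expectZ D c f : expect D (fun E => c * f E) = c * expect D f.
Proof. by rewrite big_distrr; apply: eq_bigr => E _; rewrite mulrCA. Qed.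

Lemma expectN D f : expect D (fun E => - f E) = - expect D f.
Proof. by rewrite -sumrN; apply: eq_bigr => E _; rewrite mulrN. Qed.

Lemma expect_sum (I : Type) (r : seq I) (P : pred I) D (f : I -> {set T} -> R) :
  expect D (fun E => \sum_(i <- r | P i) f i E) =
  \sum_(i <- r | P i) expect D (f i).
Proof.
by rewrite /expect exchange_big /=; apply: eq_bigr => E _; rewrite big_distrr.
Qed.

Lemma expect_set0 f : expect set0 f = f set0.
Proof.
rewrite /expect (eq_bigl (pred1 set0)) => [|E]; last by rewrite subset0.
by rewrite big_pred1_eq /weight !cards0 subnn !expr0 !mul1r.
Qed.

Lemma expect_set1 x f :
  expect [set x] f = p * f [set x] + (1 - p) * f set0.
Proof.
rewrite /expect (bigD1 [set x]) //= (bigD1 set0) /=; last first.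
  by rewrite sub0set eq_sym -card_gt0 cards1.
rewrite big1 ?addr0 => [|E /andP[/andP[]]]; last first.
  by rewrite subset1 => /orP[] /eqP->; rewrite eqxx.
by rewrite /weight !cards1 cards0 subnn !expr0 !expr1 mul1r mulr1.
Qed.

Lemma expect_cst D c : expect D (fun=> c) = c.
Proof.
elim: {D}_.+1 {-2}D (ltnSn #|D|) => // m IH D.
have [->|/set0Pn[x xD]] := eqVneq D set0; first by rewrite expect_set0.
rewrite ltnS (cardsD1 x) xD => lt_m; rewrite -(setD1K xD) expectU; last first.
  by rewrite disjoints1 !inE eqxx.
rewrite expect_set1 !IH //; ring.
Qed.

Lemma expect_centered_sqr D f : expect D (fun E => (f E - expect D f) ^+ 2) =
  expect D (fun E => f E ^+ 2) - expect D f ^+ 2.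
Proof.
set m := expect D f.
rewrite (eq_expect (g := fun E => f E ^+ 2 + ((- 2 * m) * f E + m ^+ 2))).
  by rewrite expectD expectD expectZ expect_cst -/m; ring.
by move=> E _; ring.
Qed.

Lemma probC D P : prob D (fun E => ~~ P E) = 1 - prob D P.
Proof.
rewrite -[X in X - _](expect_cst D) -expectN -expectD.
by apply: eq_expect => E _; case: (P E); rewrite ?subrr ?subr0.
Qed.

Lemma prob_miss D F : F \subset D ->
  prob D (fun E => E :&: F == set0) = (1 - p) ^+ #|F|.
Proof.
move=> sFD; rewrite /prob -{1}(setID D F) (setIidPr sFD) expectU; last first.
  by rewrite disjoints_subset setCD subsetUr.
rewrite [LHS](_ : _ = weight F set0); first by rewrite /weight cards0 subn0 mul1r.
(* Only the trace [set0] on [F] contributes; the rest of [D] then integrates to 1. *)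
rewrite {1}/expect (bigD1 set0) ?sub0set //= [X in _ + X]big1 => [|E /andP[sEF nE]].
  rewrite addr0 -[RHS]mulr1; congr (_ * _).
  rewrite -[RHS](expect_cst (D :\: F)); apply: eq_expect => E sE.
  rewrite set0U disjoint_setI0 ?eqxx // disjoints_subset.
  by apply: subset_trans sE _; rewrite setDE subsetIr.
rewrite [X in _ * X]big1 ?mulr0 // => A sA.
suff /negPf-> : (E :|: A) :&: F != set0 by rewrite mulr0.
by apply: contra nE; rewrite setIUl (setIidPl sEF) setU_eq0 => /andP[].
Qed.

(** Events that depend on disjoint sets are independent: conditioning on [F i] leaves a random
    subset of [D :\: F i], which contains all the remaining sets of the family. *)
Lemma prob_hit_all (I : eqType) (s : seq I) (F : I -> {set T}) D :
  uniq s -> (forall i, i \in s -> F i \subset D) ->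
  {in s &, forall i j, i != j -> [disjoint F i & F j]} ->
  prob D (fun E => all (fun i => E :&: F i != set0) s) =
  \prod_(i <- s) (1 - (1 - p) ^+ #|F i|).
Proof.
elim: s D => [|i s IH] D /=.
  by move=> _ _ _; rewrite big_nil -[RHS](expect_cst D).
move=> /andP[nis us] sFD dF.
have sFiD := sFD i (mem_head _ _).
have dFi : [disjoint F i & D :\: F i].
  by rewrite disjoints_subset setCD subsetUr.
rewrite big_cons -(IH (D :\: F i)) //; first last.
- by move=> j k js ks; apply: dF; rewrite inE ?js ?ks orbT.
- move=> j js; rewrite finset.subsetD sFD ?inE ?js ?orbT //= disjoint_sym.
  by apply: dF; rewrite ?inE ?eqxx ?js ?orbT //; apply: contraNneq nis => ->.
rewrite -(prob_miss (subxx (F i))) -probC.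
rewrite /prob -{1}(setID D (F i)) (setIidPr sFiD) expectU //.
rewrite [RHS]mulrC -expectZ; apply: eq_expect => E sE.
rewrite mulrC -expectZ; apply: eq_expect => A sA.
rewrite -natrM mulnb; congr (nat_of_bool (_ && _))%:R.
  rewrite setIUl [A :&: _]disjoint_setI0 ?setU0 // disjoint_sym.
  exact: disjointWr sA _.
apply: eq_in_all => j js; congr (_ != _).
rewrite setIUl [E :&: _]disjoint_setI0 ?set0U //; apply: disjointWl sE _.
by apply: dF; rewrite ?inE ?eqxx ?js ?orbT //; apply: contraNneq nis => ->.
Qed.

Hypotheses (p_ge0 : 0 <= p) (p_le1 : p <= 1).

Lemma weight_ge0 D E : 0 <= weight D E.
Proof. by rewrite mulr_ge0 ?exprn_ge0 // subr_ge0. Qed.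

Lemma le_expect D f g : (forall E, E \subset D -> f E <= g E) ->
  expect D f <= expect D g.
Proof. by move=> fg; apply: ler_sum => E /fg; apply/ler_wpM2l/weight_ge0. Qed.

Lemma expect_norm D f : `|expect D f| <= expect D (fun E => `|f E|).
Proof.
apply: le_trans (ler_norm_sum _ _ _) _; apply: ler_sum => E _.
by rewrite normrM ger0_norm ?weight_ge0.
Qed.

Lemma le_prob D (P Q : {set T} -> bool) :
  (forall E, E \subset D -> P E -> Q E) -> prob D P <= prob D Q.
Proof.
move=> PQ; apply: le_expect => E sE; rewrite ler_nat.
by case: (P E) (PQ E sE) => // ->.
Qed.

Lemma prob_le1 D P : prob D P <= 1.
Proof.
by rewrite -[leRHS](expect_cst D); apply: le_expect => E _; rewrite lern1 leq_b1.
Qed.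

Lemma prob_or D (P Q : {set T} -> bool) :
  prob D (fun E => P E || Q E) <= prob D P + prob D Q.
Proof.
rewrite -expectD; apply: le_expect => E _.
by case: (P E) (Q E) => [] [] /=; lra.
Qed.

Lemma prob_exists (I : finType) (J : pred I) D (P : I -> {set T} -> bool) :
  prob D (fun E => [exists i in J, P i E]) <= \sum_(i in J) prob D (P i).
Proof.
rewrite -expect_sum; apply: le_expect => E _.
have [/existsP[i /andP[iJ PiE]]|_] := boolP [exists i in J, P i E]; last first.
  by apply: sumr_ge0 => i _; rewrite ler0n.
by rewrite (bigD1 i) //= PiE lerDl; apply: sumr_ge0 => j _; rewrite ler0n.
Qed.

End RandomSubset.

(** * Variance bound for block-Lipschitz functions, and Chebyshev *)

Section Concentration.
Variables (R : realType) (T : finType) (p : R).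
Hypotheses (p_ge0 : 0 <= p) (p_le1 : p <= 1).
Implicit Types (B D E F : {set T}) (f g : {set T} -> R).
Notation expect := (expect p).
Notation prob := (prob p).

(** Every value lies within 1 of every other, hence within 1 of the mean, so the variance is at most
    1. *)
Lemma expect_sqr_le_osc1 B f :
  (forall E F, E \subset B -> F \subset B -> `|f E - f F| <= 1) ->
  expect B (fun E => f E ^+ 2) <= expect B f ^+ 2 + 1.
Proof.
move=> f1; rewrite -lerBlDl -expect_centered_sqr // -[leRHS](expect_cst p B).
apply: le_expect => // E sE; rewrite -real_normK ?num_real // expr_le1 //.
rewrite -{1}(expect_cst p B (f E)) -expectN -expectD.
apply: le_trans (expect_norm p_ge0 p_le1 _ _) _.
by rewrite -[leRHS](expect_cst p B); apply: le_expect => // F sF; apply: f1.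
Qed.

Section Blocks.
Variable blk : T -> nat.

Definition agree_off i E F := forall x, blk x != i -> (x \in E) = (x \in F).

Definition block_lipschitz f :=
  forall i E F, agree_off i E F -> `|f E - f F| <= 1.

(* Efron-Stein by integrating out one block at a time. *)
Lemma expect_sqr_le_blocks D f k : block_lipschitz f ->
  (forall x, x \in D -> (blk x < k)%N) ->
  expect D (fun E => f E ^+ 2) <= expect D f ^+ 2 + k%:R.
Proof.
elim: k D f => [|k IH] D f lipf ltD.
  have -> : D = set0 by apply/setP => x; rewrite inE; apply/negP => /ltD.
  by rewrite !expect_set0 addr0.
pose B := [set x in D | blk x == k]; pose C := [set x in D | blk x != k].
have dCB : [disjoint C & B].
  by rewrite -setI_eq0; apply/eqP/setP => x; rewrite !inE; case: eqP; rewrite ?andbF.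
have <- : C :|: B = D.
  by apply/setP => x; rewrite !inE; case: eqP; rewrite ?andbF ?andbT ?orbF.
(* [g] is the conditional expectation given the blocks below [k]. Averaging over block [k] costs at
   most 1 in the second moment and keeps the Lipschitz property. *)
rewrite !expectU //; pose g E := expect B (fun F => f (E :|: F)).
apply: le_trans (_ : expect C (fun E => g E ^+ 2 + 1) <= _).
  apply: le_expect => // E sE; apply: expect_sqr_le_osc1 => F F' sF sF'.
  apply: (lipf k) => x nxk; rewrite !inE; congr (_ || _).
  have nxB : x \notin B by rewrite inE (negPf nxk) andbF.
  by rewrite (contraNF (subsetP sF x) nxB) (contraNF (subsetP sF' x) nxB).
rewrite expectD expect_cst -[k.+1]addn1 natrD addrA lerD2r; apply: IH.
  move=> i E F EF; rewrite /g -expectN -expectD.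
  apply: le_trans (expect_norm p_ge0 p_le1 _ _) _.
  rewrite -[leRHS](expect_cst p B); apply: le_expect => // A _.
  by apply: (lipf i) => x /EF xEF; rewrite !inE xEF.
by move=> x; rewrite inE => /andP[/ltD]; rewrite ltnS leq_eqVlt => /orP[->|].
Qed.

End Blocks.

Lemma prob_large_of_prob0 D f (eps s : R) : 0 < eps -> 0 < s ->
  expect D (fun E => f E ^+ 2) <= expect D f ^+ 2 + eps * s ^+ 2 ->
  eps <= prob D (fun E => f E == 0) ->
  prob D (fun E => 2 * s < f E) <= eps.
Proof.
move=> eps0 s0; rewrite -lerBlDl -expect_centered_sqr //; set m := expect D f => leV ge0.
(* On [f E = 0] the deviation from the mean is [m], so [eps * m ^+ 2] is at most the variance. *)
have m_le : m <= s.
  rewrite leNgt; apply/negP => lt_sm.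
  suff : eps * m ^+ 2 <= eps * s ^+ 2 by rewrite ler_pM2l // ler_sqr ?nnegrE; lra.
  apply: le_trans leV; apply: le_trans (_ : prob D (fun E => f E == 0) * m ^+ 2 <= _).
    by rewrite ler_wpM2r ?sqr_ge0.
  rewrite mulrC -expectZ; apply: le_expect => // E _.
  by case: eqP => [->|_]; rewrite ?mulr0 ?sqr_ge0 // mulr1 sub0r sqrrN.
(* Since [m <= s], the event [2 * s < f E] forces a deviation larger than [s]. *)
rewrite -(ler_pM2r (exprn_gt0 2 s0)); apply: le_trans leV.
rewrite mulrC -expectZ; apply: le_expect => // E _.
have [lt_f|_] := boolP (2 * s < f E); last by rewrite mulr0 sqr_ge0.
by rewrite mulr1 ler_sqr ?nnegrE; lra.
Qed.

End Concentration.

(** * Colourings of vertex subsets, the deletion number, saturated partial colourings *)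

Section Colouring.
Variable n : nat.
Implicit Types (E F : {set {set 'I_n}}) (S U W : {set 'I_n}) (k l b r : nat).
Local Open Scope nat_scope.

(** Colours are natural numbers bounded only on [S], so colourings can be restricted, shifted and
    merged without a change of type. *)
Definition set_colorable E S k : Prop :=
  exists c : 'I_n -> nat, (forall x, x \in S -> c x < k) /\
    {in S &, forall x y, x != y -> [set x; y] \in E -> c x != c y}.

Lemma set_colorable0 E k : set_colorable E set0 k.
Proof. by exists (fun=> 0); split=> [x|x y]; rewrite inE. Qed.

Lemma set_colorable_sub E S U k l : U \subset S -> k <= l ->
  set_colorable E S k -> set_colorable E U l.
Proof.
move=> /subsetP sUS lekl [c [ltc cE]]; exists c; split=> [x /sUS/ltc ltx|x y xU yU].
  exact: leq_trans lekl.
by apply: cE; apply: sUS.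
Qed.

Lemma set_colorableU E S U k l : set_colorable E S k -> set_colorable E U l ->
  set_colorable E (S :|: U) (k + l).
Proof.
move=> [c [ltc cE]] [d [ltd dE]].
exists (fun x => if x \in S then c x else k + d x); split=> [x|x y].
  rewrite inE; case: ifP => [xS _|_ /= /ltd]; last by rewrite ltn_add2l.
  exact: leq_trans (ltc x xS) (leq_addr _ _).
rewrite !inE; case: ifP => xS; case: ifP => yS //= xU yU nxy xyE; first exact: cE.
- by rewrite neq_ltn (leq_trans (ltc x xS) (leq_addr _ _)).
- by rewrite neq_ltn (leq_trans (ltc y yS) (leq_addr _ _)) orbT.
- by rewrite eqn_add2l; apply: dE.
Qed.

Lemma colorableP E k : E \subset pairs n ->
  reflect (set_colorable E [set: 'I_n] k) (colorable E k).
Proof.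
move=> /subsetP sE; apply: (iffP existsP) => [[c /forall_inP cE]|[c [ltc cE]]].
  exists (fun x => c x : nat); split=> // x y _ _ nxy xyE.
  have /forall_inP/(_ x (set21 _ _))/forall_inP/(_ y (set22 _ _)) := cE _ xyE.
  by rewrite nxy.
exists [ffun x => Ordinal (ltc x (in_setT x))].
apply/forall_inP => e eE; apply/forall_inP => x xe; apply/forall_inP => y ye.
apply/implyP => nxy; rewrite !ffunE -val_eqE /=; apply: cE => //; rewrite ?inE //.
suff <- : e = [set x; y] by [].
have := sE e eE; rewrite inE => /eqP e2; apply/esym/eqP.
by rewrite eqEcard subUset !sub1set xe ye cards2 nxy e2.
Qed.

Lemma chi_le_card E : E \subset pairs n -> chi E <= n.
Proof.
move=> sE; rewrite /chi.
suff : find (colorable E) (iota 0 n.+1) < n.+1 by [].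
rewrite -[X in _ < X](size_iota 0) -has_find; apply/hasP; exists n.
  by rewrite mem_iota leq0n add0n ltnSn.
apply/colorableP => //; exists (@nat_of_ord n); split=> [x _|x y _ _ nxy _].
  exact: ltn_ord.
by rewrite val_eqE.
Qed.

Lemma chi_leP E k : E \subset pairs n ->
  reflect (set_colorable E [set: 'I_n] k) (chi E <= k).
Proof.
move=> sE; have le_n := chi_le_card sE; apply: (iffP idP) => [lek|cE].
  apply: set_colorable_sub (subxx _) lek _; apply/colorableP => //.
  rewrite -[X in colorable E X](@nth_iota 0 0 n.+1) // nth_find //.
  by rewrite has_find size_iota.
have [len|/ltnW/(leq_trans le_n)//] := leqP k n; rewrite leqNgt; apply/negP.
move=> /(before_find 0); rewrite nth_iota ?ltnS //.
by move/colorableP: cE => /(_ sE) ->.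
Qed.

(** The variable Y of the overview, encoded through a largest [b]-colourable set; the empty set
    guarantees that one exists. *)
Definition deletion b E : nat :=
  #|~: [arg max_(S > set0 | `[< set_colorable E S b >]) #|S|]|.

Lemma deletion_le b E S : set_colorable E S b -> deletion b E <= #|~: S|.
Proof.
rewrite /deletion; case: arg_maxnP => [|U _ maxU cS].
  by apply/asboolP; apply: set_colorable0.
have /maxU : `[< set_colorable E S b >] by apply/asboolP.
by have := cardsC U; have := cardsC S; lia.
Qed.

Lemma deletionP b E : exists2 S, set_colorable E S b & #|~: S| = deletion b E.
Proof.
rewrite /deletion; case: arg_maxnP => [|U /asboolP cU _]; last by exists U.
by apply/asboolP; apply: set_colorable0.
Qed.

(** Vertex exposure: an edge belongs to the block of its larger endpoint, so every edge of block [i]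
    contains vertex [i]. *)
Definition last_vertex (e : {set 'I_n}) : nat := \max_(i in e) i.

(** Deleting vertex [i] as well leaves only edges outside block [i], on which [E] and [F] agree. *)
Lemma deletion_agree_off b i E F : agree_off last_vertex i E F ->
  deletion b F <= (deletion b E).+1.
Proof.
move=> EF; have [S [c [ltc cE]] <-] := deletionP b E.
pose U := [set x in S | x != i :> nat].
have sUS : U \subset S by apply/subsetP => x; rewrite inE => /andP[].
apply: leq_trans (_ : #|~: U| <= _).
  apply: deletion_le; exists c; split=> [x /(subsetP sUS)/ltc//|x y].
  rewrite !inE => /andP[xS nxi] /andP[yS nyi] nxy xyF; apply: cE => //.
  rewrite EF // /last_vertex big_setU1 ?inE //= big_set1.
  by rewrite /maxn; case: ifP.
have [ltin|leni] := ltnP i n.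
  have -> : U = S :\ Ordinal ltin by apply/setP => x; rewrite !inE andbC -val_eqE.
  by rewrite setCD setUC; apply: leq_trans (leq_card_setU _ _) _; rewrite cards1.
have -> // : U = S.
apply/setP => x; rewrite inE; have := ltn_ord x.
by case: eqP => [->|_ _]; rewrite ?andbT // ltnNge leni.
Qed.

(** The colouring comes from a largest [r]-colourable [U] in [S], with [None] for uncoloured
    vertices: if [v] had no neighbour of colour [i], giving it colour [i] would enlarge [U].
    Encoding it as a finite function makes a union bound over colourings possible. *)
Lemma exists_saturated_colouring E S r :
  ~ (exists U, [/\ U \subset S, #|S| <= 2 * #|U| & set_colorable E U r]) ->
  exists c : {ffun 'I_n -> option 'I_r},
    [/\ c \in pffun_on None S predT,
        #|S| <= 2 * #|[set v in S | c v == None]| &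
        forall v i, v \in S -> c v = None ->
          exists2 u, c u = Some i & [set v; u] \in E].
Proof.
move=> nU; pose P U := (U \subset S) && `[< set_colorable E U r >].
have P0 : P set0 by rewrite /P sub0set; apply/asboolP/set_colorable0.
case: (arg_maxnP (fun U => #|U|) P0) => U /andP[sUS /asboolP[c [ltc cE]]] maxU.
pose d := [ffun x => if x \in U then insub (c x) else None : option 'I_r].
have dE x : x \in U -> exists2 i, d x = Some i & c x = i :> nat.
  by move=> xU; exists (Ordinal (ltc x xU)) => //; rewrite ffunE xU; apply: insubT.
have dN x : (d x == None) = (x \notin U).
  have [/dE[i ->]|] // := boolP (x \in U).
  by rewrite ffunE => /negPf->.
exists d; split.
- apply/pffun_onP; split=> [|y _]; last by rewrite inE.
  by apply/subsetP => x; rewrite inE dN negbK => /(subsetP sUS).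
- have -> : #|[set v in S | d v == None]| = #|S :\: U|.
    by apply: eq_card => x; rewrite !inE dN andbC.
  rewrite leqNgt; apply/negP => ltS; apply: nU; exists U; split=> //; last by exists c.
  by have := cardsID U S; rewrite (setIidPr sUS); move: ltS; lia.
move=> v i vS /eqP; rewrite dN => nvU; apply: contrapT => nu.
suff /maxU : P (v |: U) by rewrite cardsU1 nvU; lia.
rewrite /P subUset sub1set vS sUS; apply/asboolP.
have col u : u \in U -> c u = i -> [set v; u] \notin E.
  move=> uU cu; apply/negP => vuE; apply: nu; exists u => //.
  by have [j -> cj] := dE u uU; congr Some; apply: val_inj; rewrite /= -cj.
exists (fun x => if x == v then i : nat else c x); split=> [x|x y].
  by rewrite !inE; case: eqP => [_ _|_ /ltc//]; apply: ltn_ord.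
rewrite !inE; case: (eqVneq x v) => [->|nxv] /=; case: (eqVneq y v) => [->|nyv] //=.
- by move=> _ yU _; apply: contraTneq => ciy; apply: col.
- by move=> xU _ _; rewrite setUC; apply: contraTneq => cxi; apply: col.
- exact: cE.
Qed.

End Colouring.

(** * With high probability, half of every vertex set can be coloured cheaply *)

Section HalfColouring.
Variables (R : realType) (n : nat) (p : R).
Hypotheses (p_ge0 : 0 <= p) (p_lt1 : p < 1).
Implicit Types (E : {set {set 'I_n}}) (S U W : {set 'I_n}).

Let q_gt0 : 0 < 1 - p. Proof. by rewrite subr_gt0. Qed.
Let p_le1 : p <= 1. Proof. exact: ltW. Qed.

(* Jensen's inequality for the exponential, through its tangent at the mean. *)
Lemma sum_expR_ge (r : nat) (l a : R) (x : 'I_r -> R) : 0 <= l ->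
  \sum_i x i <= r%:R * a ->
  r%:R * expR (- (l * a)) <= \sum_i expR (- (l * x i)).
Proof.
move=> l0 sumx.
apply: le_trans (_ : \sum_i expR (- (l * a)) * (1 + l * (a - x i)) <= _); last first.
  apply: ler_sum => i _.
  have -> : - (l * x i) = - (l * a) + l * (a - x i) by ring.
  by rewrite expRD ler_pM2l ?expR_gt0 ?expR_ge1Dx.
rewrite -big_distrr big_split /= -big_distrr /= sumrB !sumr_const card_ord.
rewrite -mulr_natl -[a *+ r]mulr_natl mulr1 mulrC ler_pM2l ?expR_gt0 //.
by rewrite lerDl mulr_ge0 // subr_ge0.
Qed.

Definition saturated r S (c : {ffun 'I_n -> option 'I_r}) E : bool :=
  [forall v in [set v in S | c v == None], forall i,
     exists u, (c u == Some i) && ([set v; u] \in E)].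

(** For uncoloured [v] and colour [i], the edge set must meet the star [F (v, i)] from [v] to class
    [C i]. These stars are disjoint, so the probability is a product of factors
    [1 - (1 - p) ^+ #|C i|]; then [1 - t <= expR (- t)] and Jensen over the classes give the
    bound. *)
Lemma prob_saturated r S (c : {ffun 'I_n -> option 'I_r}) :
  (0 < r)%N -> c \in pffun_on None S predT ->
  prob p (pairs n) (saturated S c) <=
  expR (- (#|[set v in S | c v == None]|%:R *
    (r%:R * expR (- (- ln (1 - p) * (#|S|%:R / r%:R)))))).
Proof.
move=> r_gt0 /pffun_onP[/subsetP suppS _]; set W := [set v in S | c v == None].
pose C i := [set u | c u == Some i].
pose F (vi : 'I_n * 'I_r) := [set [set vi.1; u] | u in C vi.2].
pose s := enum [set vi : 'I_n * 'I_r | vi.1 \in W].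
have sW vi : (vi \in s) = (vi.1 \in W) by rewrite mem_enum inE.
have nWC v i u : v \in W -> u \in C i -> v != u.
  by rewrite !inE => /andP[_ /eqP cv] /eqP cu; apply: contra_eq_neq cu => <-; rewrite cv.
have injF v i : v \in W -> {in C i &, injective (fun u => [set v; u])}.
  move=> vW u w uC wC /setP/(_ u); rewrite !inE eqxx orbT.
  by rewrite eq_sym (negPf (nWC _ _ _ vW uC)) => /esym/eqP.
apply: le_trans (_ : prob p (pairs n) (fun E => all (fun vi => E :&: F vi != set0) s) <= _).
  apply: le_prob => // E _ /forall_inP sat; apply/allP => -[v i]; rewrite sW /= => vW.
  have /forallP/(_ i)/existsP[u /andP[cu vuE]] := sat v vW.
  apply/set0Pn; exists [set v; u]; rewrite inE vuE; apply/imsetP; exists u => //.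
  by rewrite inE.
rewrite prob_hit_all ?enum_uniq //; first last.
(* In a common edge of two stars the uncoloured endpoint must be the same, as the other endpoint is
   coloured; its colour then determines [i]. *)
- move=> [v i] [w j]; rewrite !sW /= => vW wW; apply: contra_neqT.
  rewrite -setI_eq0 => /set0Pn[e /setIP[/imsetP[u uC ->] /imsetP[x xC /setP vuwx]]].
  have /orP[/eqP vw|/eqP vx] : (v == w) || (v == x).
  - by have := vuwx v; rewrite !inE eqxx => /esym.
  - have ux : u = x.
      apply: (injF v i vW) => //; last by apply/setP => y; rewrite vuwx vw.
      have := vuwx u; rewrite !inE eqxx orbT => /esym/orP[/eqP uw|/eqP ux].
        by have := nWC _ _ _ vW uC; rewrite uw vw eqxx.
      by move: uC; rewrite ux inE.
    rewrite vw; congr pair.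
    by move: uC xC; rewrite ux !inE => /eqP-> /eqP[].
  - by have := nWC _ _ _ vW xC; rewrite vx eqxx.
- move=> [v i]; rewrite sW /= => vW; apply/subsetP => e /imsetP[u uC ->].
  by rewrite inE cards2 (nWC _ _ _ vW uC).
set l := - ln (1 - p).
have l_ge0 : 0 <= l by rewrite oppr_ge0 ln_le0 // gerBl.
have qE k : (1 - p) ^+ k = expR (- (l * k%:R)).
  by rewrite /l mulNr opprK mulrC expRM_natl lnK.
apply: le_trans (_ : \prod_(vi <- s) expR (- ((1 - p) ^+ #|F vi|)) <= _).
  apply: ler_prod => vi _; rewrite expR_ge1Dx andbT subr_ge0.
  by rewrite exprn_ile1 ?gerBl // ltW.
rewrite -expR_sum ler_expR sumrN lerN2 big_enum.
rewrite (eq_big (fun vi => (vi.1 \in W) && xpredT vi.2)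
  (fun vi => expR (- (l * #|C vi.2|%:R)))) => [|vi|[v i]]; first last.
- by rewrite inE /= => vW; rewrite qE card_in_imset //; apply: injF.
- by rewrite !inE andbT.
rewrite -(pair_big (mem W) xpredT (fun v i => expR (- (l * #|C i|%:R)))) /=.
rewrite sumr_const -[leRHS]mulr_natl ler_wpM2l // sum_expR_ge //.
(* The colour classes are disjoint subsets of [S], so their average size is at most [#|S| / r]. *)
rewrite mulrCA mulfV ?mulr1 ?pnatr_eq0 -?lt0n // -natr_sum ler_nat.
under eq_bigr do rewrite -sum1_card.
rewrite (exchange_big_dep (mem S)) /= => [|i u _]; last first.
  by rewrite inE => /eqP cu; apply: suppS; rewrite inE cu.
rewrite -[leqRHS]sum1_card leq_sum // => u _.
rewrite (eq_bigl (fun i => c u == Some i)) => [|i]; last by rewrite !inE.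
case: (c u) => [i|]; last by rewrite big_pred0_eq.
by rewrite (big_pred1 i) // => j; rewrite /= (inj_eq Some_inj) eq_sym.
Qed.

Definition half_colorable E S r : Prop :=
  exists U, [/\ U \subset S, (#|S| <= 2 * #|U|)%N & set_colorable E U r].

(** Union bound over at most [n ^ s] sets and [r.+1 ^ s] partial colourings. At least [s / 2]
    vertices stay uncoloured, so the exponential bound is an [s]-th power too. *)
Lemma prob_not_half_colorable (s r : nat) : (0 < r)%N ->
  prob p (pairs n)
    (fun E => [exists (S : {set 'I_n} | #|S| == s), ~~ `[< half_colorable E S r >]]) <=
  ((n * r.+1)%:R * expR (- (2^-1 * (r%:R *
      expR (- (- ln (1 - p) * (s%:R / r%:R))))))) ^+ s.
Proof.
move=> r_gt0; set X := r%:R * _.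
have X_ge0 : 0 <= X by rewrite mulr_ge0 ?expR_ge0.
pose J S := [pred c : {ffun 'I_n -> option 'I_r} |
  (c \in pffun_on None S predT) && (#|S| <= 2 * #|[set v in S | c v == None]|)%N].
apply: le_trans (_ : prob p (pairs n) (fun E =>
  [exists (S : {set 'I_n} | #|S| == s),
     exists (c : {ffun 'I_n -> option 'I_r} | J S c), saturated S c E]) <= _).
  apply: le_prob => // E _ /existsP[S /andP[cS /asboolP nS]].
  apply/existsP; exists S; rewrite cS /=.
  have [c [cS' cW sat]] := exists_saturated_colouring nS.
  apply/existsP; exists c; rewrite /= cS' cW /=.
  apply/forall_inP => v; rewrite inE => /andP[vS /eqP cv]; apply/forallP => i.
  have [u cu vuE] := sat v i vS cv.
  by apply/existsP; exists u; rewrite cu vuE eqxx.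
apply: le_trans (prob_exists p_ge0 p_le1 _ _ _) _.
apply: le_trans (_ : \sum_(S : {set 'I_n} | #|S| == s) (r.+1 ^ s)%:R *
  expR (- (2^-1 * X)) ^+ s <= _).
  apply: ler_sum => S /eqP cS.
  apply: le_trans (prob_exists p_ge0 p_le1 _ _ _) _.
  apply: le_trans (_ : \sum_(c in J S) expR (- (2^-1 * X)) ^+ s <= _).
    apply: ler_sum => c /andP[cS' cW].
    apply: le_trans (prob_saturated r_gt0 cS') _.
    rewrite -expRM_natl ler_expR cS -/X mulrN lerN2 mulrA ler_wpM2r //.
    rewrite ler_pdivrMr // mulrC -natrM ler_nat -cS; exact: cW.
  rewrite sumr_const -[leLHS]mulr_natl ler_wpM2r ?exprn_ge0 ?expR_ge0 // ler_nat.
  apply: leq_trans (_ : #|pffun_on (None : option 'I_r) S predT| <= _)%N.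
    by apply/subset_leq_card/subsetP => c /andP[].
  rewrite card_pffun_on cS; apply: eq_leq; congr (_ ^ _)%N.
  by rewrite -[in RHS](card_ord r) -card_option; apply: eq_card.
rewrite sumr_const -[leLHS]mulr_natl mulrA exprMn -natrM ler_wpM2r ?exprn_ge0 ?expR_ge0 //.
rewrite -natrX ler_nat expnMn leq_mul2r; apply/orP; right.
apply: leq_trans (_ : 'C(n, s) <= _)%N.
  rewrite -[X in 'C(X, _)]card_ord -card_draws; apply: subset_leq_card.
  by apply/subsetP => S; rewrite !inE.
rewrite -(leq_pmul2r (fact_gt0 s)) bin_ffact.
apply: leq_trans (leq_pmulr _ (fact_gt0 s)).
rewrite ffact_prod -[X in (_ <= _ ^ X)%N]card_ord -prod_nat_const.
by apply: leq_prod => i _; apply: leq_subr.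
Qed.

Lemma prob_all_half_colorable (r : nat -> nat) (y : R) :
  0 <= y -> y <= 1 ->
  (forall s, (0 < s <= n)%N -> (0 < r s)%N /\
    (n * (r s).+1)%:R * expR (- (2^-1 * ((r s)%:R *
      expR (- (- ln (1 - p) * (s%:R / (r s)%:R)))))) <= y) ->
  prob p (pairs n)
    (fun E => ~~ `[< forall S, S != set0 -> half_colorable E S (r #|S|) >]) <=
  n%:R * y.
Proof.
move=> y_ge0 y_le1 ry.
(* The index [s] stands for size [s.+1], so the sizes range from 1 to [n]. *)
pose Q (s : 'I_n) E :=
  [exists (S : {set 'I_n} | #|S| == s.+1), ~~ `[< half_colorable E S (r s.+1) >]].
apply: le_trans (_ : prob p (pairs n) (fun E => [exists s in 'I_n, Q s E]) <= _).
  apply: le_prob => // E _ /asboolPn /existsNP[S /not_implyP[S0 nS]].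
  have cS : (#|S|.-1 < n)%N.
    by rewrite prednK ?card_gt0 // -[leqRHS]card_ord max_card.
  apply/existsP; exists (Ordinal cS); rewrite inE /=; apply/existsP; exists S.
  by rewrite prednK ?card_gt0 // eqxx; apply/asboolPn.
apply: le_trans (prob_exists p_ge0 p_le1 _ _ _) _.
rewrite -[X in X%:R * y]card_ord mulr_natl -sumr_const; apply: ler_sum => s _.
have [rs0 rsy] := ry s.+1 (ltn_ord s).
apply: le_trans (prob_not_half_colorable _ rs0) _.
apply: le_trans (_ : y ^+ s.+1 <= _); last by rewrite exprS ler_piMr ?exprn_ile1.
by rewrite lerXn2r ?nnegrE // mulr_ge0 ?expR_ge0.
Qed.

End HalfColouring.

(** Each round uses fresh colours and at least halves the uncoloured set: the linear terms form a
    geometric series with sum at most [2 * A * #|S|], and [r0] is paid once in each of at most [k]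
    rounds. *)
Lemma set_colorable_of_half (R : realType) n (E : {set {set 'I_n}})
    (r : nat -> nat) (A r0 : R) :
  (forall s, (r s)%:R <= A * s%:R + r0) ->
  (forall S : {set 'I_n}, S != set0 -> half_colorable E S (r #|S|)) ->
  0 <= A -> 0 <= r0 ->
  forall k (S : {set 'I_n}), (#|S| < 2 ^ k)%N ->
  exists2 L, L%:R <= 2 * A * #|S|%:R + k%:R * r0 & set_colorable E S L.
Proof.
move=> rA halfE A_ge0 r0_ge0 k S.
have [->|S0] := eqVneq S set0.
  move=> _; exists 0%N; last exact: set_colorable0.
  by rewrite addr_ge0 ?mulr_ge0.
elim: k S S0 => [|k IH] S S0 ltS; first by move: ltS S0; rewrite -card_gt0; case: #|S|.
have [U [sUS leSU cU]] := halfE S S0.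
have cSU : (#|U| + #|S :\: U| = #|S|)%N by rewrite -(cardsID U S) (setIidPr sUS).
have [SU0|SU0] := eqVneq (S :\: U) set0.
  exists (r #|S|); last first.
    by apply: set_colorable_sub cU => //; rewrite -setD_eq0 SU0.
  apply: le_trans (rA _) _; apply: lerD.
    by rewrite -mulrA ler_peMl ?mulr_ge0 // ler1n.
  by rewrite ler_peMl // ler1n.
have [|L leL cL] := IH _ SU0.
  by move: ltS; rewrite expnS; lia.
exists (r #|S| + L)%N; last first.
  apply: set_colorable_sub (set_colorableU cU cL) => //.
  by rewrite -subDset.
have leSU' : 2 * #|S :\: U|%:R <= #|S|%:R :> R by rewrite -natrM ler_nat; lia.
have := ler_wpM2l A_ge0 leSU'; have := rA #|S|.
by rewrite natrD -[k.+1]addn1 natrD mulrDl mul1r; lra.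
Qed.

(** * A window for the chromatic number at fixed [n] *)

Section Window.
Variables (R : realType) (n : nat) (p : R).
Hypotheses (n_gt0 : (0 < n)%N) (p_ge0 : 0 <= p) (p_le1 : p <= 1).

Lemma expect_deletion_sqr_le b :
  expect p (pairs n) (fun E => (deletion b E)%:R ^+ 2) <=
  expect p (pairs n) (fun E => (deletion b E)%:R) ^+ 2 + n%:R.
Proof.
apply: (expect_sqr_le_blocks p_ge0 p_le1 (blk := @last_vertex n)) => [i E F EF|e _].
  have FE : agree_off (@last_vertex n) i F E by move=> x /EF.
  have := deletion_agree_off b EF; have := deletion_agree_off b FE.
  rewrite -!(ler_nat R) -!natr1 ler_norml.
  by move=> ? ?; apply/andP; split; lra.
suff : (last_vertex e <= n.-1)%N by rewrite -ltnS prednK.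
by apply/bigmax_leqP => i _; rewrite -ltnS prednK.
Qed.

(** Three bad events are excluded: [chi E < b], more than [2 * d] deletions, and a small set that is
    not [L]-colourable. The relation between [d] and [eps] makes the variance bound [n] equal to
    [eps * d ^+ 2]. *)
Lemma chi_window (eps d y : R) (L : nat) :
  0 < eps -> eps <= 1 -> 0 < d -> eps * d ^+ 2 = n%:R ->
  prob p (pairs n) (fun E => ~~ `[< forall S : {set 'I_n},
    #|S|%:R <= 2 * d -> set_colorable E S L >]) <= y ->
  exists2 b, (b <= n)%N &
    1 - (2 * eps + y) <= prob p (pairs n) (fun E => (b <= chi E <= b + L)%N).
Proof.
move=> eps_gt0 eps_le1 d_gt0 epsd ley.
have ex_b : exists b, eps <= prob p (pairs n) (fun E => chi E <= b)%N.
  exists n; apply: le_trans eps_le1 _; rewrite -(expect_cst p (pairs n) 1).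
  by apply: le_expect => // E sE; rewrite chi_le_card.
have [b eps_b min_b] := ex_minnP ex_b.
exists b.
  apply: min_b; apply: le_trans eps_le1 _; rewrite -(expect_cst p (pairs n) 1).
  by apply: le_expect => // E sE; rewrite chi_le_card.
have lt_b : prob p (pairs n) (fun E => chi E < b)%N <= eps.
  case: b {eps_b} min_b => [|b] min_b.
    by rewrite /prob /expect big1 ?(ltW eps_gt0) // => E _; rewrite mulr0.
  have [le_eps|/ltW//] := leP eps (prob p (pairs n) (fun E => chi E <= b)%N).
  by have := min_b _ le_eps; rewrite ltnn.
have del : prob p (pairs n) (fun E => 2 * d < (deletion b E)%:R) <= eps.
  apply: prob_large_of_prob0 => //.
    by rewrite epsd; apply: expect_deletion_sqr_le.
  apply: le_trans eps_b _; apply: le_prob => // E sE /(chi_leP _ sE)/deletion_le.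
  by rewrite setCT cards0 leqn0 pnatr_eq0.
rewrite lerBlDr -lerBlDl -probC mulr2n mulrDl mul1r.
apply: le_trans (lerD (lerD lt_b del) ley).
apply: le_trans (lerD (prob_or p_ge0 p_le1 _ _ _) (lexx _)).
apply: le_trans (prob_or p_ge0 p_le1 _ _ _).
apply: le_prob => // E sE; apply: contraNT; rewrite !negb_or negbK -leqNgt -leNgt.
move=> /andP[/andP[-> le_d] /asboolP colE] /=.
(* The kept vertices take [b] colours and the deleted ones [L] fresh colours. *)
apply/chi_leP => //; have [S cS cSE] := deletionP b E.
rewrite -(setUCr S); apply: set_colorableU cS _.
by apply: colE; rewrite cSE.
Qed.

End Window.

(** * Elementary estimates for logarithm and exponential *)

Lemma ler_truncn (R : realType) (x : R) : 0 <= x -> (Num.truncn x)%:R <= x.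
Proof. by move=> x0; rewrite Num.Theory.truncn_le. Qed.

Lemma half_le_ln2 (R : realType) : 2^-1 <= ln 2 :> R.
Proof.
have := @le_ln1Dx R (- 2^-1) ltac:(lra).
have -> : 1 + - 2^-1 = 2^-1 :> R by field.
by rewrite lnV ?posrE //; lra.
Qed.

(** The left side is [ln (1 + p / (1 - p))], at most [p / (1 - p)]. *)
Lemma oppr_ln1B_le (R : realType) (p delta : R) :
  0 < p -> 0 < delta -> p <= 1 - delta ->
  - ln (1 - p) <= p / delta.
Proof.
move=> p0 d0 pd; have q0 : 0 < 1 - p by lra.
rewrite -lnV ?posrE //; have -> : (1 - p)^-1 = 1 + p / (1 - p) by field; lra.
have pq0 : 0 <= p / (1 - p) by rewrite divr_ge0; lra.
apply: le_trans (le_ln1Dx _) _; first by lra.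
by rewrite ler_pM2l // lef_pV2 ?posrE; lra.
Qed.

(** Squaring [expR (c * x / 2) >= c * x / 2] gives a quadratic lower bound, which beats [K * x] from
    the stated threshold on. *)
Lemma expR_ge_linear (R : realType) (c K x : R) : 0 < c -> 0 <= K ->
  4 * K / c ^+ 2 <= x -> K * x <= expR (c * x).
Proof.
move=> c0 K0; rewrite ler_pdivrMr ?exprn_gt0 // => Kx.
have x0 : 0 <= x.
  rewrite leNgt; apply/negP => x0.
  by have : x * c ^+ 2 < 0; [rewrite pmulr_llt0 ?exprn_gt0 | lra].
have -> : c * x = c * x / 2 + c * x / 2 by field.
rewrite expRD -expr2; have := @expR_ge1Dx R (c * x / 2).
have cx0 : 0 <= c * x / 2 by rewrite divr_ge0 ?mulr_ge0 // ltW.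
move=> le1; apply: le_trans (_ : (c * x / 2) ^+ 2 <= _); last first.
  by rewrite ler_sqr ?nnegrE ?expR_ge0 //; lra.
have -> : (c * x / 2) ^+ 2 = x * c ^+ 2 * x / 4 by field.
by rewrite ler_pdivlMr // mulrAC [_ * 4]mulrC ler_wpM2r.
Qed.

(** * Choice of the numbers of colours for large [n] *)

Section LargeN.
Variables (R : realType) (n : nat) (p delta : R).
Hypotheses (p_gt0 : 0 < p) (delta_gt0 : 0 < delta) (delta_lt1 : delta < 1).
Hypothesis p_le : p <= 1 - delta.
Let x : R := ln n%:R.
(** This is [n] to the power [delta / 4]; [p_large] thus bounds [Num.sqrt n%:R * p] below by [n] to
    the power [delta]. *)
Let X : R := expR (delta / 4 * x).
Hypotheses (x_ge1 : 1 <= x) (xX : 10 * x <= X).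
Hypothesis n_large : 4 / delta ^+ 2 + 4 <= n%:R.
Hypothesis p_large : X ^+ 4 <= Num.sqrt n%:R * p.

Let C0 : R := 4 / delta ^+ 2.
Let A : R := C0 * p / x.
(** The first summand keeps the average class size [s / r s] small enough that [1 - p] to that power
    is at least [X^-1]; [C0] is tuned to this. The second makes [r s] at least [X ^+ 2], also for
    small [s]. *)
Let r (s : nat) : nat := ((Num.truncn (A * s%:R)).+1 + (Num.truncn (X ^+ 2)).+1)%N.

Let n_gt0 : (0 < n)%N.
Proof.
rewrite lt0n; apply/eqP => n0; move: n_large; rewrite n0.
have : 0 < 4 / delta ^+ 2 by rewrite divr_gt0 ?exprn_gt0.
by lra.
Qed.

Let x_gt0 : 0 < x. Proof. by move: x_ge1; lra. Qed.
Let C0_gt0 : 0 < C0. Proof. by rewrite divr_gt0 ?exprn_gt0. Qed.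
Let A_ge0 : 0 <= A. Proof. exact/ltW/divr_gt0/x_gt0/mulr_gt0. Qed.
Let X_gt0 : 0 < X. Proof. exact: expR_gt0. Qed.
Let nE : n%:R = expR x :> R. Proof. by rewrite lnK // posrE ltr0n. Qed.

Let r_le s : (r s)%:R <= A * s%:R + (X ^+ 2 + 2).
Proof.
rewrite natrD -!natr1; have := ler_truncn (mulr_ge0 A_ge0 (ler0n R s)).
by have := ler_truncn (sqr_ge0 X); lra.
Qed.

Let A_le_r s : A * s%:R <= (r s)%:R.
Proof.
have := ltW (Num.Theory.truncnS_gt (A * s%:R)); rewrite natrD.
by have := ler0n R (Num.truncn (X ^+ 2)).+1; lra.
Qed.

Let X_le_r s : X ^+ 2 <= (r s)%:R.
Proof.
have := ltW (Num.Theory.truncnS_gt (X ^+ 2)); rewrite natrD.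
by have := ler0n R (Num.truncn (A * s%:R)).+1; lra.
Qed.

(** The inner product is at least [X ^+ 2 / X = X >= 10 * x], so the exponential factor is at most
    [n ^- 5], while [n_large] bounds the prefactor by [n ^ 3]. *)
Let union_bound s : (0 < s <= n)%N -> (0 < r s)%N /\
    (n * (r s).+1)%:R * expR (- (2^-1 * ((r s)%:R *
      expR (- (- ln (1 - p) * (s%:R / (r s)%:R)))))) <= n%:R ^- 2.
Proof.
move=> /andP[s_gt0 s_le]; have r_gt0 : (0 < r s)%N by rewrite /r addnS.
split=> //; have rR : 0 < (r s)%:R :> R by rewrite ltr0n.
have le1 : - ln (1 - p) * (s%:R / (r s)%:R) <= delta / 4 * x.
  rewrite mulrA ler_pdivrMr //.
  apply: le_trans (_ : p / delta * s%:R <= _).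
    by rewrite ler_wpM2r // oppr_ln1B_le.
  have -> : p / delta * s%:R = delta / 4 * x * (A * s%:R).
    by rewrite /A /C0; field; rewrite !gt_eqF.
  by rewrite ler_wpM2l // mulr_ge0 ?divr_ge0 // ltW.
have le2 : X <= (r s)%:R * expR (- (- ln (1 - p) * (s%:R / (r s)%:R))).
  apply: le_trans (_ : X ^+ 2 * X^-1 <= _); first by rewrite expr2 mulfK ?gt_eqF.
  apply: ler_pM => //; rewrite ?sqr_ge0 ?invr_ge0 ?expR_ge0 // /X -expRN.
  by rewrite ler_expR lerN2.
apply: le_trans (_ : n%:R ^+ 3 * expR (- (5 * x)) <= _); last first.
  rewrite -[5]/(5%:R) -mulrN expRM_natl expRN -nE exprVn.
  have n0 : n%:R != 0 :> R by rewrite pnatr_eq0 -lt0n.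
  by rewrite le_eqVlt; apply/orP; left; apply/eqP; field.
apply: ler_pM; rewrite ?expR_ge0 //; last first.
  by rewrite ler_expR lerN2; move: xX; lra.
have Xn : X ^+ 2 <= n%:R.
  rewrite nE /X -expRM_natl ler_expR; have := x_gt0; have := delta_lt1; nra.
have An : A * s%:R <= C0 * n%:R.
  apply: ler_pM => //; last by rewrite ler_nat.
  rewrite /A -mulrA ler_piMr ?(ltW C0_gt0) // ler_pdivrMr //.
  by move: p_le delta_gt0 x_ge1; lra.
have n1 : 1 <= n%:R :> R by rewrite ler1n.
rewrite natrM exprS ler_wpM2l // -natr1; have := r_le s.
have : (C0 + 4) * n%:R <= n%:R ^+ 2 by rewrite expr2 ler_wpM2r.
by rewrite /C0; move: An Xn n1; rewrite /C0; lra.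
Qed.

Lemma chi_window_large (eps : R) : 0 < eps -> eps <= 1 ->
  exists b L : nat, [/\ (b <= n)%N,
    L%:R <= (16 / (delta ^+ 2 * Num.sqrt eps) + 1) * (Num.sqrt n%:R * p / x) &
    1 - (2 * eps + n%:R^-1) <= prob p (pairs n) (fun E => (b <= chi E <= b + L)%N)].
Proof.
move=> eps_gt0 eps_le1.
have p_lt1 : p < 1 by move: p_le delta_gt0; lra.
have n0 : 0 < n%:R :> R by rewrite ltr0n.
have se0 : 0 < Num.sqrt eps by rewrite sqrtr_gt0.
pose d := Num.sqrt n%:R / Num.sqrt eps.
have d_gt0 : 0 < d by rewrite divr_gt0 ?sqrtr_gt0.
(* Enough halving rounds: [k > 2 * ln n] and [ln 2 >= 1/2] give [n < 2 ^ k]. *)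
pose k := (Num.truncn (2 * x)).+1.
(* The colour count of the iterated halving for sets of size at most [2 * d]. *)
pose M := 4 * A * d + k%:R * (X ^+ 2 + 2).
have X2_ge0 : 0 <= X ^+ 2 + 2 by rewrite addr_ge0 ?sqr_ge0.
have M_ge0 : 0 <= M.
  by apply: addr_ge0; apply: mulr_ge0 => //; [exact: mulr_ge0 | exact: ltW].
have epsd : eps * d ^+ 2 = n%:R.
  by rewrite /d expr_div_n !sqr_sqrtr; [field; rewrite gt_eqF | exact: ltW..].
have bad : prob p (pairs n) (fun E => ~~ `[< forall S : {set 'I_n},
    #|S|%:R <= 2 * d -> set_colorable E S (Num.truncn M) >]) <= n%:R^-1.
  have -> : n%:R^-1 = n%:R * n%:R ^- 2 :> R by field; rewrite gt_eqF.
  have y_le1 : n%:R ^- 2 <= 1 :> R.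
    by rewrite invf_le1 ?exprn_gt0 // exprn_ege1 // ler1n.
  have y_ge0 : 0 <= n%:R ^- 2 :> R by rewrite invr_ge0 sqr_ge0.
  apply: le_trans (prob_all_half_colorable (ltW p_gt0) p_lt1 y_ge0 y_le1 union_bound).
  apply: le_prob => [||E _]; [exact: ltW | exact: ltW |].
  apply: contra => /asboolP halfE; apply/asboolP => S leS.
  have ltS : (#|S| < 2 ^ k)%N.
    apply: leq_ltn_trans (max_card _) _; rewrite card_ord -(ltr_nat R) nE.
    rewrite natrX -[2%:R](@lnK R) ?posrE // -expRM_natl ltr_expR.
    have : 2 * x < k%:R by apply: Num.Theory.truncnS_gt.
    by have := half_le_ln2 R; have := x_gt0; nra.
  have [L leL] := set_colorable_of_half r_le halfE A_ge0 X2_ge0 ltS.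
  apply: set_colorable_sub => //; rewrite Num.Theory.truncn_ge_nat //.
  apply: le_trans leL _; rewrite lerD2r.
  by have := ler_wpM2l A_ge0 leS; lra.
have [b b_le prob_b] := chi_window n_gt0 (ltW p_gt0) (ltW p_lt1) eps_gt0 eps_le1
  d_gt0 epsd bad.
exists b, (Num.truncn M); split=> //.
apply: le_trans (ler_truncn M_ge0) _; rewrite /M [leRHS]mulrDl mul1r; apply: lerD.
  rewrite le_eqVlt; apply/orP; left; apply/eqP; rewrite /A /C0 /d; field.
  by rewrite !gt_eqF.
(* The per-round costs are of lower order: with [k <= 3 * x] and [10 * x <= X], their product with
   [x] is at most [9 * x ^+ 2 * X ^+ 2 <= X ^+ 4]. *)
rewrite ler_pdivlMr //; apply: le_trans p_large.
have kx : k%:R <= 3 * x.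
  have kE : k%:R = (Num.truncn (2 * x))%:R + 1 :> R by rewrite natr1.
  have := @ler_truncn R (2 * x) ltac:(move: x_gt0; lra).
  by move: x_ge1; rewrite kE; lra.
apply: le_trans (_ : 3 * x * (3 * X ^+ 2) * x <= _).
  rewrite ler_pM2r // ler_pM //.
  have X10 : 10 <= X by move: xX x_ge1; lra.
  by nra.
have -> : X ^+ 4 = X ^+ 2 * X ^+ 2 by ring.
have -> : 3 * x * (3 * X ^+ 2) * x = 9 * x ^+ 2 * X ^+ 2 by ring.
rewrite ler_wpM2r ?sqr_ge0 //.
by move: xX x_ge1; nra.
Qed.

End LargeN.

(** * Passage to the limit *)

Lemma Pr_GnpE (R : realType) n (p : R) (P : {set {set 'I_n}} -> bool) :
  Pr_Gnp p P = prob p (pairs n) P.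
Proof.
rewrite /Pr_Gnp /prob /expect big_mkcondr /=; apply: eq_bigr => E _.
by case: (P E); rewrite ?mulr1 ?mulr0.
Qed.

Lemma exists_max_le (R : realType) n (f : int -> R) :
  exists a : int, forall b : nat, (b <= n)%N -> f b%:Z <= f a.
Proof.
have [i _ fi] := @arg_maxP _ _ 'I_n.+1 ord0 xpredT (fun i => f (i : nat)%:Z) erefl.
by exists (i : nat)%:Z => b b_le; apply: (fi (Ordinal (b_le : (b < n.+1)%N))).
Qed.

(** Multiplying [p >= n ^ (- 1/2 + delta)] by the square root of [n] leaves [n ^ delta], the fourth
    power on the left. *)
Lemma sqrt_mul_powR_large (R : realType) n (p delta : R) : (0 < n)%N ->
  0 < p -> n%:R `^ (- 2^-1 + delta) / p <= 1 ->
  expR (delta / 4 * ln n%:R) ^+ 4 <= Num.sqrt n%:R * p.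
Proof.
move=> n_gt0 p_gt0; rewrite ler_pdivrMr // mul1r /powR pnatr_eq0 gtn_eqF // => lep.
set x := ln n%:R in lep *.
have nE : n%:R = expR (x / 2) ^+ 2 :> R.
  by rewrite -expRM_natl mulrC divfK ?pnatr_eq0 // lnK // posrE ltr0n.
rewrite nE sqrtr_sqr ger0_norm ?expR_ge0 // -expRM_natl.
apply: le_trans (ler_wpM2l (expR_ge0 _) lep); rewrite -expRD ler_expR.
by rewrite le_eqVlt; apply/orP; left; apply/eqP; field.
Qed.

Local Open Scope classical_set_scope.

Theorem theorem1 (R : realType) (omega p : nat -> R) (delta : R) :
  omega @ \oo --> +oo ->
  0 < delta -> delta < 1 ->
  (forall n, 0 < p n) ->
  (fun n : nat => (n%:R) `^ (- 2^-1 + delta) / p n) @ \oo --> (0 : R) ->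
  (forall n, p n <= 1 - delta) ->
  exists a : nat -> int,
    (fun n : nat => @Pr_Gnp R n (p n) (fun E =>
        (a n <= (chi E)%:Z) &&
        ((chi E)%:Z <= a n + Num.floor (omega n * Num.sqrt (n%:R) * p n / ln (n%:R)))))
      @ \oo --> (1 : R).
Proof.
move=> omega_oo delta_gt0 delta_lt1 p_gt0 p_large p_le.
pose len n := Num.floor (omega n * Num.sqrt (n%:R) * p n / ln (n%:R)).
pose Q n (a : int) := Pr_Gnp (p n)
  (fun E : {set {set 'I_n}} => (a <= (chi E)%:Z) && ((chi E)%:Z <= a + len n)).
(* Taking the most likely window for a n removes any dependence on epsilon. *)
have /choice[a aP] : forall n, exists a, forall b : nat, (b <= n)%N -> Q n b%:Z <= Q n a.
  by move=> n; apply: exists_max_le.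
exists a; apply/cvgrPdist_le => e e_gt0.
(* The failure probability [2 * eps + n^-1] is then at most [e] as soon as [n >= 2 / e]. *)
pose eps := Num.min 1 (e / 4).
have eps_gt0 : 0 < eps by rewrite lt_min ltr01 divr_gt0.
have [eps_le1 eps_e] : eps <= 1 /\ eps <= e / 4 by rewrite !ge_min !lexx orbT.
pose C := 16 / (delta ^+ 2 * Num.sqrt eps) + 1.
(* Threshold for [ln n] beyond which [10 * ln n] is at most [n] to the power [delta / 4]. *)
pose M := Num.max 1 (4 * 10 / (delta / 4) ^+ 2).
near=> n.
have n_e : 2 / e <= n%:R by near: n; apply: nbhs_infty_ger.
have n_large : 4 / delta ^+ 2 + 4 <= n%:R by near: n; apply: nbhs_infty_ger.
have n_M : expR M <= n%:R by near: n; apply: nbhs_infty_ger.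
have omega_C : C <= omega n by near: n; move/cvgryPge : omega_oo; apply.
have p_1 : n%:R `^ (- 2^-1 + delta) / p n <= 1.
  near: n; move/cvgrPdist_le : p_large => /(_ 1 ltr01); apply: filterS => n.
  by rewrite sub0r normrN; apply: le_trans; apply: ler_norm.
have n0 : 0 < n%:R :> R by apply: lt_le_trans n_M; apply: expR_gt0.
have n_gt0 : (0 < n)%N by rewrite -(ltr0n R).
have x_M : M <= ln n%:R by rewrite -ler_expR lnK.
have [x_ge1 x_large] : 1 <= ln n%:R :> R /\ 4 * 10 / (delta / 4) ^+ 2 <= ln n%:R.
  by move: x_M; rewrite ge_max => /andP[].
have d4 : 0 < delta / 4 by rewrite divr_gt0.
have xX := expR_ge_linear d4 (ler0n R 10) x_large.
have [b [L [b_le L_le prob_b]]] := chi_window_large (p_gt0 n) delta_gt0 delta_lt1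
  (p_le n) x_ge1 xX n_large (sqrt_mul_powR_large n_gt0 (p_gt0 n) p_1) eps_gt0 eps_le1.
have pn1 : p n <= 1 by have := p_le n; lra.
rewrite -/(Q n (a n)) ger0_norm; last first.
  by rewrite subr_ge0 /Q Pr_GnpE prob_le1 // ltW.
have n_e2 : n%:R^-1 <= e / 2.
  by rewrite -[e / 2]invrK lef_pV2 ?posrE ?invr_gt0 ?divr_gt0 // invf_div.
suff : 1 - (2 * eps + n%:R^-1) <= Q n (a n) by lra.
(* The window of length [L] at [b] lies in the one of length [len n] at [b], which is no likelier
   than the one at [a n]. *)
apply: le_trans (aP n b b_le); apply: le_trans prob_b _.
rewrite /Q Pr_GnpE; apply: le_prob => [||E _ /andP[b_chi chi_L]]; rewrite ?(ltW (p_gt0 n)) //.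
rewrite lez_nat b_chi /=; apply: le_trans (_ : b%:Z + L%:Z <= _).
  by rewrite -PoszD lez_nat.
(* As [L] is an integer, the floor may be dropped; then [C <= omega n] absorbs the constant
   depending on [eps]. *)
rewrite lerD2l /len Num.Theory.floor_ge_int; apply: le_trans L_le _.
rewrite -[leRHS]mulrA -[leRHS]mulrA [X in _ <= _ * X]mulrA.
apply: ler_wpM2r; last exact: omega_C.
by rewrite divr_ge0 ?mulr_ge0 ?sqrtr_ge0 ?(ltW (p_gt0 n)) //; lra.
Unshelve. all: by end_near.
Qed.
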